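(* Let $Z\sim N(0,1)$. For each integer $n\ge 1$ let $X_1(n)$ be the number of tosses of a fair coin until reaching, for the first time, either $n$ Heads or $n$ Tails. Then, as $n\to\infty$, $$\frac{X_1(n)-2n}{\sqrt n}\ \overset{\mathrm d}{\longrightarrow}\ -\sqrt2\,|Z|,$$ and, for the centered variables, $$\frac{X_1(n)-\mathbb E[X_1(n)]}{\sqrt n}\ \overset{\mathrm d}{\longrightarrow}\ -\sqrt2\,\bigl(|Z|-\mathbb E|Z|\bigr).$$
   Context: Tosses are independent, each giving Heads or Tails with probability $1/2$. Let $H_N$ and $T_N$ be the number of Heads and Tails, respectively, among the first $N$ tosses. Then $X_1(n)=\min\{N: H_N=n \text{ or } T_N=n\}$. The symbol $\overset{\mathrm d}{\longrightarrow}$ denotes convergence in distribution. *)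

(* Defs.v *)
From mathcomp Require Import all_boot all_order all_algebra.
From mathcomp Require Import all_classical all_reals all_analysis.
From mathcomp Require Import zify.
Import Order.TTheory GRing.Theory Num.Theory.
Import numFieldNormedType.Exports.

Set Implicit Arguments.
Unset Strict Implicit.
Unset Printing Implicit Defensive.

Local Open Scope classical_set_scope.
Local Open Scope ring_scope.

Definition mutually_independent d d' (T : measurableType d)
    (T' : measurableType d') (R : realType) (P : probability T R)
    (X : nat -> {RV P >-> T'}) : Prop :=
  forall (s : seq nat) (A : nat -> set T'),
    uniq s -> (forall k, measurable (A k)) ->
    P (\bigcap_(k in [set` s]) X k @^-1` A k) =
      (\prod_(k <- s) P (X k @^-1` A k))%E.

(* The random variables converge in distribution when their distribution
   functions converge at every continuity point of the limiting one. The limit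
   may live on another probability space, only its law matters. The functions
   are given unbundled, so that they can be written pointwise; being random
   variables (measurable) is part of the definition. *)
Definition cvg_in_distribution d d' (T : measurableType d)
    (T' : measurableType d') (R : realType) (P : probability T R)
    (Q : probability T' R) (X : nat -> T -> R) (Y : T' -> R) : Prop :=
  [/\ forall n, measurable_fun setT (X n),
      measurable_fun setT Y &
      forall x : R, {for x, continuous (fun t : R => Q [set w | Y w <= t])} ->
        P [set w | X n w <= x] @[n --> \oo] --> Q [set w | Y w <= x]].

(* Equality is required on measurable sets only, since the values of measures
   outside the sigma-algebra carry no meaning. *)
Definition standard_normal d (T : measurableType d) (R : realType)
    (Q : probability T R) (Z : {RV Q >-> R}) : Prop :=
  forall A : set R, measurable A -> distribution Q Z A = normal_prob 0 1 A.

(* toss k is the (k+1)-st toss, true stands for Heads and false for Tails *)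
Definition fair_coin_tosses d (T : measurableType d) (R : realType)
    (P : probability T R) (toss : nat -> {RV P >-> bool}) : Prop :=
  mutually_independent toss /\
  forall k b, P (toss k @^-1` [set b]) = (2^-1)%:E.

Section first_time.
Context d (T : measurableType d) (R : realType) (P : probability T R).
Variable toss : nat -> {RV P >-> bool}.

Definition heads (N : nat) (w : T) : nat := (\sum_(k < N) toss k w)%N.

Definition tails (N : nat) (w : T) : nat := (\sum_(k < N) ~~ toss k w)%N.

Definition reached (n : nat) (w : T) (N : nat) : bool :=
  (heads N w == n) || (tails N w == n).

Lemma reached_ex (n : nat) (w : T) : exists N, reached n w N.
Proof.
case: n => [|n]; first by exists 0%N; rewrite /reached /heads big_ord0 eqxx.
apply: contrapT => /forallNP H.
have HT N : (heads N w + tails N w = N)%N.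
  rewrite /heads /tails -big_split/= (eq_bigr (fun=> 1%N)).
    by rewrite sum1_card card_ord.
  by move=> k _; case: (toss k w).
have {}H N : (heads N w <= n)%N && (tails N w <= n)%N.
  elim: N => [|N /andP[hN tN]]; first by rewrite /heads /tails !big_ord0.
  have := H N.+1; rewrite /reached /heads /tails !big_ord_recr/=.
  rewrite -/(heads N w) -/(tails N w); case: (toss N w) => /=; lia.
have := H (n.*2.+1)%N; have := HT (n.*2.+1)%N; lia.
Qed.

Definition first_time (n : nat) (w : T) : nat := ex_minn (reached_ex n w).

Definition X1 (n : nat) (w : T) : R := (first_time n w)%:R.

Let measurable_count (f : nat -> T -> bool) N n :
  (forall k, measurable_fun setT (f k)) ->
  measurable [set w | (\sum_(k < N) f k w)%N = n].
Proof.
move=> mf; elim: N n => [|N IH] n.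
  case: n => [|n].
    rewrite (_ : [set _ | _] = setT)//.
    by apply/seteqP; split=> w//= _; rewrite big_ord0.
  rewrite (_ : [set _ | _] = set0)//.
  by apply/seteqP; split=> w//=; rewrite big_ord0.
have mfN b : measurable (f N @^-1` [set b]).
  by rewrite -[_ @^-1` _]setTI; exact: mf.
rewrite (_ : [set _ | _] =
    (f N @^-1` [set false] `&` [set w | (\sum_(k < N) f k w)%N = n]) `|`
    (f N @^-1` [set true] `&` [set w | (0 < n)%N /\ (\sum_(k < N) f k w)%N = n.-1])).
  apply: measurableU; apply: measurableI => //.
  case: n => [|n]; last first.
    rewrite (_ : [set _ | _] = [set w | (\sum_(k < N) f k w)%N = n])//.
    by apply/seteqP; split=> w/=; [case|].
  by rewrite (_ : [set _ | _] = set0)//; apply/seteqP; split=> w//= -[].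
apply/seteqP; split=> w/=; rewrite big_ord_recr/=; case: (f N w) => /=.
- by move=> h; right; split=> //; lia.
- by move=> h; left; split=> //; lia.
- by case=> -[]// _ []; lia.
- by case=> -[]// _; lia.
Qed.

Let measurable_reached n N : measurable [set w | reached n w N].
Proof.
rewrite (_ : [set _ | _] = [set w | heads N w = n] `|` [set w | tails N w = n]).
  apply: measurableU; first by apply: (@measurable_count toss) => k; exact: measurable_funPT.
  apply: (@measurable_count (fun k w => ~~ toss k w)) => k.
  by apply: measurable_neg; exact: measurable_funPT.
apply/seteqP; split=> w/=.
  by rewrite /reached => /orP[] /eqP; [left|right].
by rewrite /reached => -[] ->; rewrite eqxx ?orbT.
Qed.

Lemma measurable_X1 n : measurable_fun setT (X1 n).
Proof.
move=> _ B _; rewrite setTI.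
rewrite (_ : _ @^-1` _ = \bigcup_(N in [set N | B N%:R])
   ([set w | reached n w N] `&`
    \bigcap_(M in [set M | (M < N)%N]) ~` [set w | reached n w M])).
  apply: bigcup_measurable => N _; apply: measurableI => //.
  apply: bigcap_measurableType => M _; exact: measurableC.
apply/seteqP; split=> w/=.
  rewrite /X1 /first_time; case: ex_minnP => N rN minN BN.
  exists N => //; split=> // M /= MN /minN; by rewrite leqNgt MN.
move=> [N /= BN [rN minN]]; rewrite /X1 /first_time.
case: ex_minnP => M rM minM; rewrite (_ : M = N)//; apply/eqP.
rewrite eqn_leq minM//= leqNgt; apply/negP => MN.
exact: (minN M MN).
Qed.

End first_time.

(* Main.v *)
Require Import Defs.
From mathcomp Require Import all_boot all_order all_algebra.
From mathcomp Require Import all_classical all_reals all_analysis.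
From mathcomp Require Import measurable_realfun ring lra zify.
Import Order.TTheory GRing.Theory Num.Theory.
Import numFieldNormedType.Exports.

Local Open Scope classical_set_scope.
Local Open Scope ring_scope.

(** Write n = m + 1. The tosses stop after at most 2 n - 1 = 2 m + 1 steps, and
    the shortfall J = 2 m + 1 - X_1(n) has an explicit law, that of Banach's
    matchbox problem: stopping at toss N + 1 means that the first N tosses
    contain exactly m Heads (or exactly m Tails) and that toss N + 1 is of the
    same kind, whence P(J = j) = C(2 m - j, m) / 2 ^ (2 m - j)
    ([probability_first_time]).

    These weights decrease from j = 0 on, the ratio of consecutive ones being
    1 - j / (2 m - j). With M = sqrt (2 m), the product of these ratios gives
    P(J = j) / P(J = 0) --> exp (- s^2 / 2) when j / M --> s
    ([cvg_matchbox_ratio]), and also a bound of these quotients by a fixed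
    Gaussian in s = j / M ([matchbox_dominated]). A sum over j is M / 2 times
    the Lebesgue integral over the line of a step function of |s|, constant
    where floor (|s| M) = j. So dominated convergence turns averages
    over J / M into integrals of functions of |s| against exp (- s^2 / 2). The
    unknown factor P(J = 0) is eliminated by dividing by the same statement
    for the constant function 1: no asymptotics of the central binomial
    coefficient (Stirling, Wallis) enters. The result is [cvg_matchbox_avg]:
    E h_m(J) --> E g(|Z|) as soon as h_m(j) <= 1 + j / M and
    h_m (floor (|s| M)) --> g(s) for almost every s.

    Two choices of h_m yield the theorem. The identity j / M, allowed by the
    linear growth of the bound, gives E J / M --> E |Z|
    ([cvg_shortfall_mean]); the indicator of c_m <= j, with c_m / M --> c, gives
    P(J >= c_m) --> P(|Z| >= c) ([cvg_shortfall_tail]). Both normalizations of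
    X_1(n) are of the form (X_1(n) - e_n) / sqrt n, and
    [cvg_X1_in_distribution] treats them together: the event that this is at
    most x is an event J >= c_m, where M / sqrt n --> sqrt 2. *)

(** * Gaussian bounds for the matchbox weights *)

(** The law of the number of matches left in Banach's matchbox problem with
    two boxes of m matches, which is also the law of the shortfall J. *)
Definition matchbox {R : realType} (m j : nat) : R :=
  'C(2 * m - j, m)%:R / 2 ^+ (2 * m - j).

Lemma matchbox_ge0 {R : realType} m j : 0 <= matchbox m j :> R.
Proof. by rewrite divr_ge0// exprn_ge0. Qed.

Lemma matchbox0_gt0 {R : realType} m : 0 < matchbox m 0 :> R.
Proof. by rewrite divr_gt0 ?exprn_gt0// ltr0n bin_gt0; lia. Qed.

Lemma matchbox_gtn {R : realType} m j : (m < j)%N -> (0 < m)%N ->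
  matchbox m j = 0 :> R.
Proof. by move=> mj m0; rewrite /matchbox bin_small ?mul0r//; lia. Qed.

Lemma matchboxS {R : realType} m j : (0 < m)%N -> (j <= m)%N ->
  matchbox m j.+1 = matchbox m j * (1 - j%:R / (2 * m%:R - j%:R)) :> R.
Proof.
move=> m0 jm; rewrite /matchbox.
have [N EN] : exists N, (2 * m - j = N.+1)%N by exists (2 * m - j).-1; lia.
have -> : (2 * m - j.+1 = N)%N by lia.
rewrite EN exprS.
have ENR : 2 * m%:R - j%:R = N.+1%:R :> R.
  by rewrite -EN natrB ?natrM//; lia.
have /(congr1 (fun n => n%:R : R)) : (N.+1 * 'C(N, m) = (N.+1 - m) * 'C(N.+1, m))%N.
  by rewrite mul_bin_down.
rewrite !natrM ENR natrB; last by lia.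
have N0 : N.+1%:R != 0 :> R by [].
have p0 : 2 ^+ N != 0 :> R by rewrite expf_neq0.
have -> : j%:R = 2 * m%:R - N.+1%:R :> R by rewrite -ENR; ring.
move=> H.
have -> : 'C(N, m)%:R = (N.+1%:R - m%:R) * 'C(N.+1, m)%:R / N.+1%:R :> R.
  by rewrite -H mulrC mulKf.
by field; rewrite p0 nat1r N0.
Qed.

(** Each factor satisfies 1 - i / (2 m - i) <= 1 - i / (2 m) <= exp (- i / (2 m)),
    and the exponents i / (2 m), i < j, add up to j (j - 1) / (4 m). *)
Lemma matchbox_ub {R : realType} m j : (0 < m)%N ->
  matchbox m j <=
  matchbox m 0 * expR (- (j%:R * (j%:R - 1) / (4 * m%:R))) :> R.
Proof.
move=> m0; have mR : 0 < m%:R :> R by rewrite ltr0n.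
have [jm|mj] := leqP j m; last first.
  by rewrite matchbox_gtn// mulr_ge0 ?expR_ge0// ltW// matchbox0_gt0.
elim: j jm => [_|j IH jm].
  by rewrite mul0r mul0r oppr0 expR0 mulr1.
rewrite matchboxS//; last by lia.
have jmR : j.+1%:R <= m%:R :> R by rewrite ler_nat.
have j0 : 0 <= j%:R :> R by [].
rewrite -natr1 in jmR *.
have E : - ((j%:R + 1) * (j%:R + 1 - 1) / (4 * m%:R)) =
    - (j%:R * (j%:R - 1) / (4 * m%:R)) + - (j%:R / (2 * m%:R)) :> R.
  by field; rewrite gt_eqF.
rewrite E expRD mulrA ler_pM ?matchbox_ge0//.
- by rewrite subr_ge0 ler_pdivrMr; lra.
- by apply: IH; lia.
apply: le_trans (expR_ge1Dx _).
by rewrite lerD2l lerN2 ler_wpM2l// lef_pV2 ?posrE; lra.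
Qed.

(** The inverse of a factor is 1 + i / (2 m - 2 i) <= exp (i / (2 m - 2 i)). The
    index l decouples the denominator, 2 (m - l) for all factors, from the
    induction on j; the lemma is used with l = j. *)
Lemma matchbox_lb {R : realType} m l j : (j <= l)%N -> (l < m)%N ->
  matchbox m 0 * expR (- (j%:R * (j%:R - 1) / (4 * (m%:R - l%:R)))) <=
  matchbox m j :> R.
Proof.
move=> + lm; have lmR : l%:R + 1 <= m%:R :> R by rewrite natr1 ler_nat.
elim: j => [_|j IH jl].
  by rewrite mul0r mul0r oppr0 expR0 mulr1.
rewrite matchboxS//; [|lia|lia].
have j0 : 0 <= j%:R :> R by [].
have jlR : j%:R + 1 <= l%:R :> R by rewrite natr1 ler_nat.
rewrite -natr1.
have ml0 : m%:R - l%:R != 0 :> R by rewrite gt_eqF; lra.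
have E : - ((j%:R + 1) * (j%:R + 1 - 1) / (4 * (m%:R - l%:R))) =
    - (j%:R * (j%:R - 1) / (4 * (m%:R - l%:R))) +
    - (j%:R / (2 * (m%:R - l%:R))) :> R.
  by field.
rewrite E expRD mulrA ler_pM//.
- by rewrite mulr_ge0 ?expR_ge0// ltW// matchbox0_gt0.
- by apply: IH; lia.
have D1 : 0 < 2 * m%:R - j%:R :> R by lra.
have D2 : 0 < 2 * m%:R - 2 * j%:R :> R by lra.
have -> : 1 - j%:R / (2 * m%:R - j%:R) =
    (1 + j%:R / (2 * m%:R - 2 * j%:R))^-1 :> R.
  field; rewrite !gt_eqF//; lra.
rewrite expRN lef_pV2 ?posrE ?expR_gt0//; last first.
  by rewrite ltr_wpDr// divr_ge0// ltW.
apply: le_trans (expR_ge1Dx _) _; rewrite ler_expR.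
by rewrite ler_wpM2l// lef_pV2 ?posrE; lra.
Qed.

(** * Convergence of the rescaled weights to a Gaussian function *)

(** The number M of the introduction, for m = k + 1: sequences are indexed by k
    so that m, hence M, is never 0. *)
Definition scale {R : realType} (k : nat) : R := Num.sqrt (2 * k.+1%:R).

Lemma scale_gt0 {R : realType} k : 0 < scale k :> R.
Proof. by rewrite sqrtr_gt0 mulr_gt0. Qed.

Lemma scale_sqr {R : realType} k : scale k ^+ 2 = 2 * k.+1%:R :> R.
Proof. by rewrite sqr_sqrtr// mulr_ge0. Qed.

Lemma cvg_scaleV {R : realType} : (scale k : R)^-1 @[k --> \oo] --> (0 : R).
Proof.
have H : Num.sqrt (2^-1 * (harmonic k : R)) @[k --> \oo] --> Num.sqrt (2^-1 * 0 : R).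
  apply: continuous_cvg; first exact: sqrt_continuous.
  by apply: cvgM; [exact: cvg_cst|exact: cvg_harmonic].
rewrite mulr0 sqrtr0 in H; apply: cvg_trans H; apply: near_eq_cvg.
by apply: nearW => k; rewrite /scale -invfM sqrtrV// mulr_ge0.
Qed.

Lemma cvg_truncn_scale {R : realType} (s : R) : 0 <= s ->
  (Num.truncn (s * scale k))%:R / scale k @[k --> \oo] --> s.
Proof.
move=> s0; apply: (@squeeze_cvgr _ _ _ _ (fun k => s - (scale k)^-1) (cst s)).
- apply: nearW => k; have M0 := @scale_gt0 R k.
  have := @truncn_itv R (s * scale k); rewrite mulr_ge0 ?(ltW M0)// => /(_ isT).
  move=> /andP[t1 t2].
  rewrite ler_pdivrMr// t1 andbT ler_pdivlMr// mulrBl mulVf ?gt_eqF//.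
  by rewrite lerBlDr natr1 ltW.
- rewrite -[X in _ --> X]subr0.
  by apply: cvgB; [exact: cvg_cst|exact: cvg_scaleV].
- exact: cvg_cst.
Qed.

(** With t = j / M and v = 1 / M, the exponents in [matchbox_ub] and
    [matchbox_lb] are t (t - v) / 2 and t (t - v) / 2 / (1 - 2 t v), which have
    the same limit. *)
Lemma cvg_matchbox_ratio {R : realType} (j : nat -> nat) (r : R) :
  (j k)%:R / scale k @[k --> \oo] --> r ->
  matchbox k.+1 (j k) / matchbox k.+1 0 @[k --> \oo] --> expR (- (r ^+ 2 / 2)).
Proof.
move=> jr.
pose t k : R := (j k)%:R / scale k; pose v k : R := (scale k)^-1.
have v0 : v k @[k --> \oo] --> (0:R) by exact: cvg_scaleV.
have num : t k * (t k - v k) / 2 @[k --> \oo] --> r ^+ 2 / 2.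
  rewrite (_ : r ^+ 2 / 2 = r * (r - 0) / 2); last by ring.
  apply: cvgM; last exact: cvg_cst.
  by apply: cvgM => //; apply: cvgB.
have den : 1 - 2 * t k * v k @[k --> \oo] --> (1:R).
  rewrite [X in _ --> X](_ : 1 = 1 - 2 * r * 0 :> R); last by ring.
  apply: cvgB; first exact: cvg_cst.
  by apply: cvgM => //; apply: cvgM => //; exact: cvg_cst.
have jE k : (j k)%:R = t k * scale k by rewrite divfK// gt_eqF// scale_gt0.
have kE k : k.+1%:R = scale k ^+ 2 / 2 :> R.
  by rewrite scale_sqr mulrC mulKf.
apply: (@squeeze_cvgr _ _ _ _
   (fun k => expR (- (t k * (t k - v k) / 2 / (1 - 2 * t k * v k))))
   (fun k => expR (- (t k * (t k - v k) / 2)))).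
- near=> k.
  have M0 := @scale_gt0 R k; have Mn0 : scale k != 0 :> R by rewrite gt_eqF.
  have b0 := @matchbox0_gt0 R k.+1.
  have D0 : 0 < 1 - 2 * t k * v k by near: k; exact: (cvgr_gt _ den).
  (* j < m amounts to 2 t v < 1, since j / m = 2 t v. *)
  have jk : (j k < k.+1)%N.
    rewrite -(ltr_nat R) jE (kE k).
    rewrite (_ : t k * scale k = scale k ^+ 2 / 2 * (2 * t k * v k)); last first.
      by rewrite /v; field.
    by rewrite gtr_pMr ?divr_gt0 ?exprn_gt0//; lra.
  apply/andP; split.
    rewrite ler_pdivlMr// mulrC.
    apply: le_trans (@matchbox_lb R _ _ _ (leqnn _) jk).
    rewrite ler_pM2l// ler_expR lerN2 le_eqVlt; apply/orP; left; apply/eqP.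
    rewrite jE (kE k) /v; field.
    have Mt : scale k - 2 * t k != 0.
      rewrite (_ : _ - _ = scale k * (1 - 2 * t k * v k)).
        by rewrite mulf_neq0// gt_eqF.
      by rewrite /v; field.
    rewrite Mn0 Mt/= (_ : _ + _ = scale k * (scale k - 2 * t k)).
      by rewrite mulf_neq0.
    by ring.
  rewrite ler_pdivrMr// mulrC.
  apply: le_trans (@matchbox_ub R k.+1 (j k) isT) _.
  rewrite ler_pM2l// ler_expR lerN2 le_eqVlt; apply/orP; left; apply/eqP.
  by rewrite jE (kE k) /v; field.
- apply: continuous_cvg; first exact: continuous_expR.
  apply: cvgN; rewrite -[X in _ --> X]divr1.
  by apply: cvgM => //; apply: cvgV.
- apply: continuous_cvg; first exact: continuous_expR.
  exact: cvgN.
Unshelve. all: by end_near. Qed.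

(** The factor 1 + j / M <= exp |s| is there to allow test functions of linear
    growth. From j + 1 > |s| M one gets j (j - 1) / (4 m) >= s^2 / 8 - 1 / 4, so
    that the product is at most exp (|s| - s^2 / 8 + 1 / 4), and the density
    of variance 9, proportional to exp (- s^2 / 18), absorbs |s| because
    1 / 18 < 1 / 8. *)
Lemma matchbox_dominated {R : realType} (s : R) k :
  (1 + (Num.truncn (`|s| * scale k))%:R / scale k) *
  (matchbox k.+1 (Num.truncn (`|s| * scale k)) / matchbox k.+1 0) <=
  expR 5 / normal_peak 3 * normal_pdf 0 3 s.
Proof.
have M0 := @scale_gt0 R k.
have := @truncn_itv R (`|s| * scale k); rewrite mulr_ge0 ?(ltW M0)// => /(_ isT).
set j := Num.truncn _; rewrite -natr1 => /andP[t1 t2].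
have b0 := @matchbox0_gt0 R k.+1.
have j0 : 0 <= j%:R :> R by [].
rewrite normal_pdfE// /normal_fun [leRHS]mulrA divfK; last first.
  by rewrite gt_eqF// normal_peak_gt0.
have H1 : 1 + j%:R / scale k <= expR `|s| :> R.
  apply: le_trans (expR_ge1Dx _).
  by rewrite lerD2l ler_pdivrMr.
have H2 : matchbox k.+1 j / matchbox k.+1 0 <= expR (- s ^+ 2 / 8 + 4^-1) :> R.
  rewrite ler_pdivrMr// mulrC; apply: le_trans (matchbox_ub _ _ _) _ => //.
  rewrite ler_pM2l// ler_expR.
  have k1 : 1 <= k.+1%:R :> R by rewrite ler1n.
  have sM : s ^+ 2 * (2 * k.+1%:R) <= (j%:R + 1) ^+ 2.
    rewrite -scale_sqr -real_normK ?num_real// -exprMn.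
    by rewrite ler_sqr ?nnegrE ?mulr_ge0 ?addr_ge0// ltW.
  suff : s ^+ 2 / 8 - 4^-1 <= j%:R * (j%:R - 1) / (4 * k.+1%:R).
    by move: (_ / (4 * _)) => q; rewrite mulNr; lra.
  rewrite ler_pdivlMr ?mulr_gt0//.
  by have := sqr_ge0 (j%:R - 1 : R); nra.
apply: (@le_trans _ _ (expR `|s| * expR (- s ^+ 2 / 8 + 4^-1))).
  by rewrite ler_pM// ?addr_ge0 ?divr_ge0 ?matchbox_ge0// ltW.
rewrite -!expRD ler_expR subr0 (_ : 3 ^+ 2 *+ 2 = 18 :> R); last by ring.
(* 36 / 5 minimizes (1 / 8 - 1 / 18) u^2 - u. *)
have := sqr_ge0 (`|s| - 36 / 5); rewrite -(real_normK (num_real s)).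
set u := `|s|; nra.
Qed.

(** * Averages against the matchbox weights as integrals of step functions *)

Section StepFunctions.
Context {R : realType} (M : R) (M0 : 0 < M).
Local Notation mu := (@lebesgue_measure R).

Definition cell (j : nat) : set R := [set s | Num.truncn (`|s| * M) = j].

(** Describing the cell as a difference of two symmetric intervals avoids
    treating its two halves, which meet when j = 0. *)
Lemma cellE j :
  cell j = `]-(j.+1%:R / M), j.+1%:R / M[ `\` `]-(j%:R / M), j%:R / M[.
Proof.
apply/seteqP; split => s; rewrite /cell/= !in_itv/= -!ltr_norml !ltr_pdivlMr//.
  move=> <-; have := @truncn_itv R (`|s| * M).
  rewrite mulr_ge0 ?(ltW M0)// => /(_ isT)/andP[le1 lt1]; split => //.
  by apply/negP; rewrite -leNgt.
move=> [lt1 /negP]; rewrite -leNgt => le1.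
by apply/eqP; rewrite truncn_eq ?mulr_ge0 ?(ltW M0)// le1.
Qed.

Lemma measurable_cell j : measurable (cell j).
Proof. by rewrite cellE; apply: measurableD; exact: measurable_itv. Qed.

Lemma lebesgue_measure_cell j : mu (cell j) = (2 / M)%:E.
Proof.
have sym r : 0 <= r -> mu `]-r, r[%classic = (2 * r)%:E.
  move=> r0; rewrite lebesgue_measure_itv/= lte_fin.
  case: ltP => [_|r1]; first by rewrite -EFinB; congr EFin; lra.
  by congr EFin; lra.
rewrite cellE measureD//=; last by rewrite sym ?ltry// divr_ge0// ltW.
rewrite [X in (_ - mu X)%E](_ : _ = `]-(j%:R / M), j%:R / M[%classic).
  rewrite !sym ?divr_ge0 ?(ltW M0)// -EFinB -natr1; congr EFin.
  by field; rewrite gt_eqF.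
apply/setIidr => s /=; rewrite !in_itv/= -!ltr_norml => /lt_le_trans; apply.
by rewrite ler_pM2r ?invr_gt0// ler_nat.
Qed.

Lemma step_fun_sum (h : nat -> R) m : (forall j, (m < j)%N -> h j = 0) ->
  forall s : R, h (Num.truncn (`|s| * M)) = \sum_(j < m.+1) h j * \1_(cell j) s.
Proof.
move=> hm s; set i := Num.truncn _.
have [im|mi] := ltnP i m.+1.
  rewrite (bigD1 (Ordinal im))//= indicE mem_set// mulr1 big1 ?addr0// => j ji.
  rewrite indicE memNset ?mulr0// => ij; case/eqP: ji; exact/val_inj.
rewrite hm// big1// => j _; rewrite indicE memNset ?mulr0// => ij.
by have := ltn_ord j; rewrite -ij ltnNge mi.
Qed.

Lemma measurable_step_fun (h : nat -> R) m :
  (forall j, (m < j)%N -> h j = 0) ->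
  measurable_fun setT (fun s : R => h (Num.truncn (`|s| * M))).
Proof.
move=> hm; under eq_fun do rewrite (step_fun_sum _ _ hm).
apply: measurable_sum => j; apply: measurable_funM => //.
by apply: measurable_indic; exact: measurable_cell.
Qed.

Lemma integral_step_fun (h : nat -> R) m :
  (forall j, 0 <= h j) -> (forall j, (m < j)%N -> h j = 0) ->
  (\int[mu]_s (h (Num.truncn (`|s| * M)))%:E =
   (2 / M * \sum_(j < m.+1) h j)%:E)%E.
Proof.
move=> h0 hm.
under eq_integral do rewrite (step_fun_sum _ _ hm) -sumEFin.
rewrite ge0_integral_sum//=; last 2 first.
- move=> j; apply/measurable_EFinP; apply: measurable_funM => //.
  by apply: measurable_indic; exact: measurable_cell.
- by move=> j s _; rewrite lee_fin mulr_ge0.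
rewrite mulr_sumr -sumEFin; apply: eq_bigr => j _.
under eq_integral do rewrite EFinM.
rewrite ge0_integralZl//=; last 2 first.
- by apply/measurable_EFinP/measurable_indic; exact: measurable_cell.
- by rewrite lee_fin.
rewrite integral_indic ?setIT//; last exact: measurable_cell.
by rewrite [X in (_ * X)%E]lebesgue_measure_cell -EFinM mulrC.
Qed.

End StepFunctions.

Definition matchbox_avg {R : realType} (m : nat) (h : nat -> R) : R :=
  \sum_(j < m.+1) h j * matchbox m j.

(** * The half-normal limit of the matchbox weights *)

Section HalfNormalLimit.
Context {R : realType}.
Local Notation mu := (@lebesgue_measure R).

(** Dominated convergence for the step functions built from
    h_k (j) P(J = j) / P(J = 0). The factor in front of the average tends to 1,
    which is the case h = 1, g = 1 of the lemma. *)
Lemma matchbox_avg_unnormalized (h : nat -> nat -> R) (g : R -> R) :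
  measurable_fun setT g ->
  (forall k j, 0 <= h k j <= 1 + j%:R / scale k) ->
  {ae mu, forall s,
     h k (Num.truncn (`|s| * scale k)) @[k --> \oo] --> g s} ->
  mu.-integrable setT (fun s => (g s * normal_pdf 0 1 s)%:E) /\
  (normal_peak 1 * 2 / (scale k * matchbox k.+1 0) *
     matchbox_avg k.+1 (h k))%:E @[k --> \oo] -->
  (\int[mu]_s (g s * normal_pdf 0 1 s)%:E)%E.
Proof.
move=> mg hb hg.
pose p : R := normal_peak 1.
have p0 : 0 < p by exact: normal_peak_gt0.
pose a k j : R := p * (h k j * (matchbox k.+1 j / matchbox k.+1 0)).
have a0 k j : 0 <= a k j.
  have /andP[h0 _] := hb k j.
  by rewrite mulr_ge0 ?(ltW p0)// mulr_ge0// divr_ge0// matchbox_ge0.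
have am k j : (k.+1 < j)%N -> a k j = 0.
  by move=> kj; rewrite /a matchbox_gtn// mul0r !mulr0.
pose F k (s : R) := (a k (Num.truncn (`|s| * scale k)))%:E.
have pdfE s : normal_pdf 0 1 s = p * expR (- (s ^+ 2 / 2)) :> R.
  by rewrite normal_pdfE// /normal_fun subr0 expr1n mulNr.
have [] := @dominated_convergence _ _ R mu setT measurableT F
  (fun s => (g s * normal_pdf 0 1 s)%:E)
  (fun s => (p * (expR 5 / normal_peak 3) * normal_pdf 0 3 s)%:E).
- move=> k; apply/measurable_EFinP.
  exact: (measurable_step_fun _ (scale_gt0 k) _ k.+1 (am k)).
- apply/measurable_EFinP/measurable_funM => //.
  exact: measurable_normal_pdf.
- have [N [mN N0 subN]] := hg; exists N; split=> //.
  apply: subset_trans subN; apply: subsetC => s /= hs _.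
  apply: cvg_EFin; first exact: nearW.
  rewrite pdfE mulrCA /comp/=.
  apply: cvgM; first exact: cvg_cst.
  apply: cvgM => //.
  rewrite -real_normK ?num_real//.
  by apply: cvg_matchbox_ratio; exact: cvg_truncn_scale.
- under [X in _.-integrable _ X]eq_fun do rewrite EFinM.
  by apply: integrableZl => //; exact: integrable_normal_pdf.
- apply: nearW => s k _; rewrite /F /= lee_fin ger0_norm//.
  rewrite -mulrA ler_pM2l//.
  apply: le_trans (matchbox_dominated s k).
  have /andP[_ h1] := hb k (Num.truncn (`|s| * scale k)).
  by rewrite ler_wpM2r// divr_ge0// matchbox_ge0.
move=> ig _ cv; split=> //; apply: cvg_trans cv; apply: near_eq_cvg.
apply: nearW => k /=.
rewrite (@integral_step_fun _ _ (scale_gt0 k) _ k.+1 (a0 k) (am k)).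
congr EFin; rewrite /matchbox_avg !mulr_sumr; apply: eq_bigr => j _.
rewrite /a -/p; field.
by rewrite !gt_eqF ?scale_gt0 ?matchbox0_gt0.
Qed.

(** Dividing [matchbox_avg_unnormalized] by its own instance h = 1, g = 1
    cancels the unknown value P(J = 0). *)
Theorem cvg_matchbox_avg (h : nat -> nat -> R) (g : R -> R) :
  measurable_fun setT g ->
  (forall k j, 0 <= h k j <= 1 + j%:R / scale k) ->
  {ae mu, forall s,
     h k (Num.truncn (`|s| * scale k)) @[k --> \oo] --> g s} ->
  matchbox_avg k.+1 (h k) / matchbox_avg k.+1 (cst 1) @[k --> \oo] -->
  fine (\int[mu]_s (g s * normal_pdf 0 1 s)%:E)%E.
Proof.
move=> mg hb hg.
have lim h' g' : mu.-integrable setT (fun s => (g' s * normal_pdf 0 1 s)%:E) /\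
    (h' k : R)%:E @[k --> \oo] --> (\int[mu]_s (g' s * normal_pdf 0 1 s)%:E)%E ->
    h' k @[k --> \oo] --> fine (\int[mu]_s (g' s * normal_pdf 0 1 s)%:E)%E.
  move=> [ig]; rewrite -[X in _ --> X]fineK; last exact: integrable_fin_num.
  by move=> /fine_cvgP[].
have cg := lim _ _ (matchbox_avg_unnormalized _ _ mg hb hg).
have /lim c1 := matchbox_avg_unnormalized (fun=> cst 1) (cst 1)
  (measurable_cst _)
  ltac:(by move=> k j; rewrite ler01 lerDl divr_ge0// ltW// scale_gt0)
  ltac:(by apply: nearW => s; exact: cvg_cst).
have i1 : (\int[mu]_s ((cst 1 s : R) * normal_pdf 0 1 s)%:E = 1)%E.
  by under eq_integral do rewrite /= mul1r; exact: integral_normal_pdf.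
rewrite i1/= in c1.
have := cvgM cg (cvgV (oner_neq0 _) c1); rewrite invr1 mulr1.
move=> cv; apply: cvg_trans (cv _ _) => {cv}; apply: near_eq_cvg; apply: nearW => k /=.
set u := normal_peak 1 * 2 / _.
have u0 : u != 0.
  by rewrite gt_eqF// divr_gt0// mulr_gt0 ?normal_peak_gt0 ?scale_gt0 ?matchbox0_gt0//.
by rewrite invfM mulrACA divff// mul1r.
Qed.

End HalfNormalLimit.

(** * The law of the first time at which n Heads or n Tails are reached *)

Section CoinTosses.
Context {R : realType} {d : measure_display} {T : measurableType d}.
Context {P : probability T R} {toss : nat -> {RV P >-> bool}}.

Lemma headsS N w : heads toss N.+1 w = (heads toss N w + toss N w)%N.
Proof. by rewrite /heads big_ord_recr. Qed.

Lemma heads_tails N w : (heads toss N w + tails toss N w = N)%N.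
Proof.
rewrite /heads /tails -big_split/= (eq_bigr (fun=> 1%N)).
  by rewrite sum1_card card_ord.
by move=> k _; case: (toss k w).
Qed.

Lemma heads_mono M N w : (M <= N)%N ->
  (heads toss M w <= heads toss N w <= heads toss M w + (N - M))%N.
Proof.
move=> MN; rewrite -(subnK MN); elim: (N - M)%N => [|e IH]; first by rewrite add0n; lia.
by rewrite addSn headsS; case: (toss _ w) => /=; lia.
Qed.

Lemma before_first_time m N w :
  (forall M, (M <= N)%N -> ~~ reached toss m.+1 w M) ->
  (heads toss N w <= m)%N /\ (N - heads toss N w <= m)%N.
Proof.
elim: N => [|N IH] H; first by rewrite /heads big_ord0.
have [|h1 h2] := IH; first by move=> M MN; apply: H; lia.
have := H N.+1 (leqnn _); have := heads_tails N.+1 w; rewrite /reached headsS.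
by case: (toss N w) => /=; lia.
Qed.

Lemma first_time_bounds m w : (m < first_time toss m.+1 w <= (2 * m).+1)%N.
Proof.
rewrite /first_time; case: ex_minnP => N rN minN; apply/andP; split.
  by have := heads_tails N w; move: rN; rewrite /reached; lia.
case: N rN minN => // N _ minN.
have [|h1 h2] := @before_first_time m N w; last by lia.
by move=> M MN; apply/negP => /minN; lia.
Qed.

(** The right-hand side says in one equation that toss N completes m + 1 Heads,
    or m + 1 Tails, according to its outcome; the range of N prevents the other
    count from having reached m + 1 earlier. *)
Lemma first_time_eq m N w : (m <= N <= 2 * m)%N ->
  first_time toss m.+1 w = N.+1 <->
  heads toss N w = (if toss N w then m else (N - m)%N).
Proof.
move=> mN; have hN := heads_tails N.+1 w; rewrite headsS in hN.
split.
  rewrite /first_time; case: ex_minnP => M0 rM minM E.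
  move: rM minM; rewrite {}E => rN minN.
  have [|h1 h2] := @before_first_time m N w.
    by move=> M MN; apply/negP => /minN; lia.
  by move: rN hN; rewrite /reached headsS; case: (toss N w) => /=; lia.
move=> H; rewrite /first_time; case: ex_minnP => M rM minM.
have : reached toss m.+1 w N.+1.
  by move: H hN; rewrite /reached headsS; case: (toss N w) => /=; lia.
move=> /minM; rewrite leq_eqVlt => /predU1P[//|]; rewrite ltnS => MN.
have := heads_mono _ _ w MN; have := heads_tails M w; move: rM.
rewrite /reached.
by move: H; case: (toss N w) => /=; lia.
Qed.

Lemma measurable_toss k b : measurable (toss k @^-1` [set b]).
Proof. by rewrite -[_ @^-1` _]setTI; exact: measurable_funPT. Qed.

Lemma measurable_heads N k : measurable [set w | heads toss N w = k].
Proof.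
elim: N k => [|N IH] k.
  have [->|k0] := eqVneq k 0%N.
    rewrite (_ : [set _ | _] = setT)//.
    by apply/seteqP; split=> w//= _; rewrite /heads big_ord0.
  rewrite (_ : [set _ | _] = set0)//.
  by apply/seteqP; split=> w//=; rewrite /heads big_ord0; lia.
rewrite (_ : [set _ | _] =
    (toss N @^-1` [set false] `&` [set w | heads toss N w = k]) `|`
    (if k is k'.+1 then
       toss N @^-1` [set true] `&` [set w | heads toss N w = k'] else set0)).
  apply: measurableU.
    by apply: measurableI => //; exact: measurable_toss.
  by case: k => [//|k]; apply: measurableI => //; exact: measurable_toss.
apply/seteqP; split=> w/=; rewrite headsS.
  case tw: (toss N w) => /=; last by move=> h; left; split=> //; lia.
  by case: k => [|k] h; right; [exfalso; lia|split=> //=; lia].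
case=> [[-> ->]|]; first by rewrite addn0.
by case: k => [//|k] [-> ->]; rewrite addn1.
Qed.

Hypothesis htoss : fair_coin_tosses toss.

Definition cylinder (s : seq nat) (b : nat -> bool) : set T :=
  \bigcap_(i in [set` s]) toss i @^-1` [set b i].

Lemma measurable_cylinder s b : measurable (cylinder s b).
Proof.
by apply: bigcap_measurableType => i _; exact: measurable_toss.
Qed.

Lemma probability_cylinder s b : uniq s ->
  P (cylinder s b) = (2 ^- size s)%:E.
Proof.
move=> us; have [indep fair] := htoss.
rewrite /cylinder indep//.
elim: s {us} => [|i s IH]; first by rewrite big_nil expr0 invr1.
by rewrite big_cons IH fair -EFinM exprS invfM.
Qed.

Lemma cylinder_cons N s b c : N \notin s ->
  cylinder (N :: s) (fun i => if i == N then c else b i) =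
  toss N @^-1` [set c] `&` cylinder s b.
Proof.
move=> Ns; apply/seteqP; split => w.
  move=> H; split; first by have := H N; rewrite /= eqxx mem_head; apply.
  move=> i /= si; have := H i; rewrite /= inE si orbT.
  by case: eqP si => [->|_ _]; [rewrite (negbTE Ns)|apply].
move=> [/= h1 h2] i /=; rewrite inE; case: eqP => [-> //|_ /=].
exact: h2.
Qed.

(** Prescribing finitely many later tosses makes the induction on N go through:
    splitting on toss N adds it to the prescribed ones, and Pascal's rule
    appears. *)
Lemma probability_heads N k s b : uniq s -> all (leq N) s ->
  P ([set w | heads toss N w = k] `&` cylinder s b) =
  ('C(N, k)%:R / 2 ^+ (N + size s))%:E.
Proof.
elim: N k s b => [|N IH] k s b us sN.
  rewrite add0n; have [->|k0] := eqVneq k 0%N.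
    rewrite bin0 mul1r -(probability_cylinder s b)//; congr (P _).
    by apply/seteqP; split=> w /= => [[]//|?]; split=> //; rewrite /heads big_ord0.
  rewrite bin0n (negbTE k0) mul0r (_ : _ `&` _ = set0) ?measure0//.
  by apply/seteqP; split=> w//= -[]; rewrite /heads big_ord0; lia.
have Ns : N \notin s.
  by apply/negP => /(allP sN); rewrite ltnn.
have usN : uniq (N :: s) by rewrite /= Ns.
have sN' : all (leq N) (N :: s).
  by rewrite /= leqnn; apply: sub_all sN => i; exact: ltnW.
have step c k' : P ([set w | heads toss N w = k'] `&`
    (toss N @^-1` [set c] `&` cylinder s b)) =
    ('C(N, k')%:R / 2 ^+ (N.+1 + size s))%:E.
  by rewrite -cylinder_cons// IH// addSnnS.
case: k => [|k].
  rewrite (etrans (bin0 N.+1) (esym (bin0 N))) -(step false); congr (P _).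
  apply/seteqP; split=> w /=; rewrite headsS.
    by case: (toss N w) => /= -[h1 h2]; do ?split=> //; lia.
  by move=> [-> [-> h]].
rewrite binS natrD mulrDl EFinD -(step false) -(step true) -measureU; last first.
- by apply/seteqP; split=> w //= [[_ [-> _]] [_ [? _]]].
- by apply: measurableI; [exact: measurable_heads|apply: measurableI;
    [exact: measurable_toss|exact: measurable_cylinder]].
- by apply: measurableI; [exact: measurable_heads|apply: measurableI;
    [exact: measurable_toss|exact: measurable_cylinder]].
congr (P _); apply/seteqP; split=> w /=; rewrite headsS.
  by case: (toss N w) => /= -[h1 h2]; [right|left]; do ?split=> //; lia.
by move=> [|] [-> [-> h]]; split=> //; lia.
Qed.

Lemma measurable_first_time n (D : set nat) :
  measurable [set w | D (first_time toss n w)].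
Proof.
rewrite (_ : [set _ | _] = \bigcup_(N in D) (X1 toss n @^-1` [set N%:R])).
  by apply: bigcup_measurable => N _; rewrite -[X in measurable X]setTI;
    apply: measurable_X1.
apply/seteqP; split=> w /=; first by exists (first_time toss n w).
by move=> [N DN] /eqP; rewrite /X1 eqr_nat => /eqP ->.
Qed.

Lemma probability_first_time m j : (j <= m)%N ->
  P [set w | first_time toss m.+1 w = (2 * m - j).+1] = (matchbox m j)%:E.
Proof.
move=> jm; set N := (2 * m - j)%N.
have mN : (m <= N <= 2 * m)%N by rewrite /N; lia.
have half c k : P ([set w | heads toss N w = k] `&` toss N @^-1` [set c]) =
    ('C(N, k)%:R / 2 ^+ N.+1)%:E.
  have := probability_heads N k [:: N] (fun=> c) isT.
  rewrite /= leqnn => /(_ isT); rewrite addn1 => <-; congr (P (_ `&` _)).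
  by rewrite /cylinder set_cons1 bigcap_set1.
rewrite (_ : [set _ | _] =
    ([set w | heads toss N w = m] `&` toss N @^-1` [set true]) `|`
    ([set w | heads toss N w = (N - m)%N] `&` toss N @^-1` [set false])).
  rewrite measureU; last first.
  - by apply/seteqP; split=> w //= [[_ ->] [_ ?]].
  - by apply: measurableI; [exact: measurable_heads|exact: measurable_toss].
  - by apply: measurableI; [exact: measurable_heads|exact: measurable_toss].
  rewrite [X in (X + _)%E]half [X in (_ + X)%E]half bin_sub; last by lia.
  rewrite -EFinD /matchbox -/N exprS; congr EFin.
  by field; rewrite expf_neq0.
apply/seteqP; split=> w /=; rewrite first_time_eq//.
  by case: (toss N w) => ->; [left|right].
by move=> [] [-> ->].
Qed.

Lemma integral_first_time m (h : nat -> R) : (forall j, 0 <= h j) ->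
  (\int[P]_w (h ((2 * m).+1 - first_time toss m.+1 w)%N)%:E =
   (matchbox_avg m h)%:E)%E.
Proof.
move=> h0; pose E (j : nat) := [set w | first_time toss m.+1 w = (2 * m - j).+1].
have hE w : h ((2 * m).+1 - first_time toss m.+1 w)%N =
    \sum_(j < m.+1) h j * \1_(E j) w.
  have := first_time_bounds m w; set F := first_time _ _ _ => bF.
  have jm : ((2 * m).+1 - F < m.+1)%N by lia.
  rewrite (bigD1 (Ordinal jm))//= indicE mem_set ?mulr1; last first.
    by rewrite /E/= -/F; lia.
  rewrite big1 ?addr0// => j ji; rewrite indicE memNset ?mulr0// => jF.
  case/eqP: ji; apply/val_inj => /=; have := ltn_ord j.
  by move: jF; rewrite /E /= -/F; lia.
under eq_integral do rewrite hE -sumEFin.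
rewrite ge0_integral_sum//=; last 2 first.
- move=> j; apply/measurable_EFinP; apply: measurable_funM => //.
  by apply: measurable_indic; exact: (measurable_first_time _ [set (2 * m - j).+1]).
- by move=> j s _; rewrite lee_fin mulr_ge0.
rewrite /matchbox_avg -sumEFin; apply: eq_bigr => j _.
under eq_integral do rewrite EFinM.
rewrite ge0_integralZl//=; last 2 first.
- apply/measurable_EFinP; apply: measurable_indic.
  exact: (measurable_first_time _ [set (2 * m - j).+1]).
- by rewrite lee_fin.
rewrite integral_indic ?setIT//; last first.
  exact: (measurable_first_time _ [set (2 * m - j).+1]).
by rewrite [X in (_ * X)%E]probability_first_time ?EFinM// -ltnS.
Qed.

(** A combinatorial identity obtained for free: the weights are the law of a
    random variable. *)
Lemma matchbox_avg_cst1 m : matchbox_avg m (cst 1) = 1 :> R.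
Proof.
have := integral_first_time m (cst 1) (fun=> ler01).
by rewrite /= integral_cst// [X in (_ * X)%E]probability_setT mule1 => -[].
Qed.

End CoinTosses.

(** * Integrals against the normal law *)

(** The normal density is a version of the Radon-Nikodym derivative, for which
    the change of variables is known. *)
Lemma ge0_integral_normal_prob {R : realType} (m s : R) (f : R -> \bar R) :
  measurable_fun setT f -> (forall x, 0 <= f x)%E ->
  (\int[normal_prob m s]_x f x =
   \int[lebesgue_measure]_x (f x * (normal_pdf m s x)%:E))%E.
Proof.
move=> mf f0.
have dom := normal_prob_dominates m s.
rewrite -(Radon_Nikodym_SigmaFinite.change_of_variables dom)//.
have iD := Radon_Nikodym_SigmaFinite.f_integrable dom.
have mpdf : measurable_fun setT (fun x => (normal_pdf m s x)%:E).
  by apply/measurable_EFinP; exact: measurable_normal_pdf.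
apply: ae_eq_integral => //.
- by apply: emeasurable_funM => //; exact: (measurable_int _ iD).
- exact: emeasurable_funM.
- apply: ae_eqe_mul2l; apply: integral_ae_eq => // A _ mA.
  by rewrite -Radon_Nikodym_SigmaFinite.f_integral.
Qed.

Lemma measurable_norm_ge {R : realType} {d : measure_display}
    {T : measurableType d} (f : T -> R) (c : R) :
  measurable_fun setT f -> measurable [set w | c <= `|f w|].
Proof.
move=> mf; rewrite -[X in measurable X]setTI.
apply: (@measurable_fun_le _ _ _ setT (cst c) (fun w => `|f w|)) => //.
exact: measurableT_comp.
Qed.

Lemma measurable_ge_norm_fun {R : realType} (c : R) :
  measurable_fun setT (fun s : R => ((c <= `|s|)%R%:R : R)).
Proof.
rewrite (_ : (fun s : R => _) = \1_[set s : R | c <= `|s|]).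
  by apply: measurable_indic; exact: (measurable_norm_ge id).
by apply/funext => s; rewrite indicE mem_setE.
Qed.

Lemma integral_boolR {R : realType} {d : measure_display}
    {T : measurableType d} (m : {measure set T -> \bar R}) (b : T -> bool) :
  measurable [set w | b w] -> (\int[m]_w (b w)%:R%:E = m [set w | b w])%E.
Proof.
move=> mb; transitivity (\int[m]_w (\1_[set w | b w] w)%:E)%E.
  by apply: eq_integral => w _; rewrite indicE mem_setE.
by rewrite integral_indic ?setIT.
Qed.

Section StandardNormal.
Context {R : realType} {d : measure_display} {T : measurableType d}.
Context {Q : probability T R} {Z : {RV Q >-> R}}.
Hypothesis hZ : standard_normal Z.

Lemma ge0_integral_standard_normal (g : R -> R) :
  measurable_fun setT g -> (forall s, 0 <= g s) ->
  (\int[Q]_w (g (Z w))%:E =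
   \int[lebesgue_measure]_s (g s * normal_pdf 0 1 s)%:E)%E.
Proof.
move=> mg g0.
have mEg : measurable_fun setT (EFin \o g) by exact/measurable_EFinP.
(* The normal law lives on the copy measurableTypeR R of R, with the same
   measurable sets; Z is viewed as a map into that copy. *)
have mZ : measurable_fun setT (Z : T -> measurableTypeR R).
  move=> mT A mA; exact: (@measurable_funPT _ _ _ _ Z mT A mA).
have := @ge0_integral_pushforward _ _ T (measurableTypeR R) R Z mZ Q setT
  (EFin \o g) measurableT mEg (fun s _ => g0 s).
rewrite preimage_setT => <-.
transitivity (\int[normal_prob 0 1]_s (g s)%:E)%E.
  by apply: eq_measure_integral => A mA _; exact: hZ.
by rewrite ge0_integral_normal_prob.
Qed.

Lemma probability_normZ_ge (c : R) :
  Q [set w | c <= `|Z w|] =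
  (\int[lebesgue_measure]_s ((c <= `|s|)%R%:R * normal_pdf 0 1 s)%:E)%E.
Proof.
rewrite -(ge0_integral_standard_normal (fun s => (c <= `|s|)%R%:R))//; last first.
  exact: measurable_ge_norm_fun.
by rewrite integral_boolR//; exact: measurable_norm_ge.
Qed.

End StandardNormal.

(** * Limit theorems for the shortfall and for the first time *)

Section Limit.
Context {R : realType}.
Context {d : measure_display} {T : measurableType d} {P : probability T R}.
Context {toss : nat -> {RV P >-> bool}}.
Hypothesis htoss : fair_coin_tosses toss.
Context {d' : measure_display} {T' : measurableType d'}.
Context {Q : probability T' R} {Z : {RV Q >-> R}}.
Hypothesis hZ : standard_normal Z.
Local Notation mu := (@lebesgue_measure R).

Lemma cvg_matchbox_avg_normal (h : nat -> nat -> R) (g : R -> R) :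
  measurable_fun setT g -> (forall s, 0 <= g s) ->
  (forall k j, 0 <= h k j <= 1 + j%:R / scale k) ->
  {ae mu, forall s,
     h k (Num.truncn (`|s| * scale k)) @[k --> \oo] --> g s} ->
  matchbox_avg k.+1 (h k) @[k --> \oo] --> fine (\int[Q]_w (g (Z w))%:E)%E.
Proof.
move=> mg g0 hb hg; rewrite (ge0_integral_standard_normal hZ)//.
apply: cvg_trans (cvg_matchbox_avg _ _ mg hb hg); apply: near_eq_cvg.
by apply: nearW => k; rewrite (matchbox_avg_cst1 htoss) divr1.
Qed.

Definition shortfall_mean (k : nat) : R :=
  matchbox_avg k.+1 (fun j => j%:R).

Lemma cvg_shortfall_mean :
  shortfall_mean k / scale k @[k --> \oo] --> fine 'E_Q[fun w => `|Z w|].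
Proof.
rewrite unlock.
apply: cvg_trans (cvg_matchbox_avg_normal (fun k j => j%:R / scale k)
  (fun s => `|s|) _ _ _ _).
- apply: near_eq_cvg; apply: nearW => k.
  rewrite /shortfall_mean /matchbox_avg mulr_suml; apply: eq_bigr => j _.
  by rewrite mulrAC.
- exact: measurableT_comp.
- by [].
- by move=> k j; rewrite lerDr ler01 divr_ge0// ltW// scale_gt0.
- by apply: nearW => s; exact: cvg_truncn_scale.
Qed.

Lemma cvg_shortfall_tail (c_ : nat -> R) (c : R) :
  c_ k / scale k @[k --> \oo] --> c ->
  P [set w | c_ k <= ((2 * k.+1).+1 - first_time toss k.+2 w)%:R] @[k --> \oo]
    --> Q [set w | c <= `|Z w|].
Proof.
move=> cc.
have fQ : Q [set w | c <= `|Z w|] \is a fin_num.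
  by apply: fin_num_measure; exact: measurable_norm_ge.
rewrite -(fineK fQ) (probability_normZ_ge hZ).
rewrite -(ge0_integral_standard_normal hZ)//; last first.
  exact: measurable_ge_norm_fun.
pose h k j : R := (c_ k <= j%:R)%R%:R.
have hb k j : 0 <= h k j <= 1 + j%:R / scale k.
  rewrite /h ler0n/=; apply: (@le_trans _ _ 1); first by rewrite lern1 leq_b1.
  by rewrite lerDl divr_ge0// ltW// scale_gt0.
have hc : {ae mu, forall s,
    h k (Num.truncn (`|s| * scale k)) @[k --> \oo] --> ((c <= `|s|)%R%:R : R)}.
  (* The indicators converge except where |s| = c. *)
  exists [set c; - c]; split.
  - by apply: measurableU; exact: measurable_set1.
  - by apply: countable_lebesgue_measure0; apply: finite_set_countable.
  - move=> s /=; apply: contra_notP => /not_orP[sc sNc].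
    have cs : c != `|s|.
      apply/eqP => cE; have [s0|s0] := leP 0 s.
        by apply: sc; rewrite cE ger0_norm.
      by apply: sNc; rewrite cE ltr0_norm// opprK.
    have dc : (Num.truncn (`|s| * scale k))%:R / scale k - c_ k / scale k
        @[k --> \oo] --> `|s| - c.
      by apply: cvgB => //; exact: cvg_truncn_scale.
    apply: cvg_near_cst; have [lt|] := ltP c `|s|.
      have : 0 < `|s| - c by rewrite subr_gt0.
      move=> /(cvgr_gt _ dc); apply: filterS => k.
      rewrite /h -mulrBl pmulr_lgt0 ?invr_gt0 ?scale_gt0// subr_gt0.
      by move=> /ltW ->; rewrite (ltW lt).
    rewrite le_eqVlt eq_sym (negbTE cs)/= => gt.
    have : `|s| - c < 0 by rewrite subr_lt0.
    move=> /(cvgr_lt _ dc); apply: filterS => k.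
    rewrite /h -mulrBl pmulr_llt0 ?invr_gt0 ?scale_gt0// subr_lt0.
    by rewrite !leNgt => ->; rewrite gt.
have := cvg_matchbox_avg_normal h (fun s => (c <= `|s|)%R%:R) (measurable_ge_norm_fun c)
  (fun=> ler0n _ _) hb hc.
move=> H; have {}H : (matchbox_avg k.+1 (h k))%:E @[k --> \oo] -->
    (fine (\int[Q]_w ((c <= `|Z w|)%R%:R)%:E)%E)%:E.
  by apply: cvg_EFin => //; exact: nearW.
apply: cvg_trans H; apply: near_eq_cvg; apply: nearW => k /=.
rewrite -(integral_first_time htoss)// integral_boolR//.
exact: (measurable_first_time _ [set N | c_ k <= ((2 * k.+1).+1 - N)%:R]).
Qed.

Lemma expectation_X1 m :
  ('E_P[X1 toss m.+1] =
  ((2 * m).+1%:R - matchbox_avg m (fun j => j%:R))%:E)%E.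
Proof.
rewrite unlock; transitivity (\int[P]_w
    ((2 * m).+1 - ((2 * m).+1 - first_time toss m.+1 w))%N%:R%:E)%E.
  apply: eq_integral => w _; rewrite /X1 subKn//.
  by have /andP[] := @first_time_bounds _ _ _ _ toss m w.
rewrite (integral_first_time htoss m (fun j => ((2 * m).+1 - j)%N%:R))//.
congr EFin; rewrite -[X in X - _]mulr1 -[X in _ * X - _](matchbox_avg_cst1 htoss m).
rewrite /matchbox_avg mulr_sumr -sumrB; apply: eq_bigr => j _ /=.
rewrite natrB; last by have := ltn_ord j; lia.
by rewrite mul1r mulrBl.
Qed.

Lemma cvg_sqrt_scale :
  Num.sqrt k.+2%:R / scale k @[k --> \oo] --> ((Num.sqrt 2)^-1 : R).
Proof.
have H : Num.sqrt (2^-1 + 2^-1 * harmonic k : R) @[k --> \oo] -->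
    Num.sqrt (2^-1 + 2^-1 * 0 : R).
  apply: continuous_cvg; first exact: sqrt_continuous.
  apply: cvgD; first exact: cvg_cst.
  by apply: cvgM; [exact: cvg_cst|exact: cvg_harmonic].
rewrite mulr0 addr0 sqrtrV// in H; apply: cvg_trans H; apply: near_eq_cvg.
apply: nearW => k; rewrite /scale -sqrtrV ?mulr_ge0// -sqrtrM//.
congr Num.sqrt; rewrite /harmonic /= -[k.+2%:R]natr1.
have : k.+1%:R != 0 :> R by [].
move: (k.+1%:R) => y y0. by field.
Qed.

(** The centering enters only through b, the limit of the centered shortfall
    (2 n - e_n) / M: it is 0 for e_n = 2 n and E |Z| for e_n = E X_1(n). The
    sequence is shifted by two since n = m + 1 = k + 2. *)
Lemma cvg_X1_in_distribution (e_ : nat -> R) (b : R) :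
  ((2 * k.+2)%:R - e_ k.+2) / scale k @[k --> \oo] --> b ->
  cvg_in_distribution P Q
    (fun n w => (X1 toss n w - e_ n) / Num.sqrt n%:R)
    (fun w => - Num.sqrt 2 * (`|Z w| - b)).
Proof.
move=> eb; split.
- move=> n; apply: measurable_funM => //; apply: measurable_funB => //.
  exact: measurable_X1.
- apply: measurable_funM => //; apply: measurable_funB => //.
  exact: measurableT_comp.
move=> x _.
have -> : [set w | - Num.sqrt 2 * (`|Z w| - b) <= x] =
    [set w | b - x * (Num.sqrt 2)^-1 <= `|Z w|].
  have s2 : 0 < Num.sqrt 2 :> R by rewrite sqrtr_gt0.
  apply/seteqP; split=> w /=; rewrite mulNr lerNl -ler_pdivrMl//.
    by rewrite mulrN mulrC; lra.
  by rewrite mulrN mulrC; lra.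
pose c_ k := (2 * k.+2)%:R - e_ k.+2 - 1 - x * Num.sqrt k.+2%:R.
have cc : c_ k / scale k @[k --> \oo] --> b - x * (Num.sqrt 2)^-1.
  rewrite -[b]subr0.
  have H : ((2 * k.+2)%:R - e_ k.+2) / scale k - (scale k)^-1
      - x * (Num.sqrt k.+2%:R / scale k) @[k --> \oo] -->
      b - 0 - x * (Num.sqrt 2)^-1.
    apply: cvgB; first by apply: cvgB => //; exact: cvg_scaleV.
    by apply: cvgM; [exact: cvg_cst|exact: cvg_sqrt_scale].
  apply: cvg_trans H; apply: near_eq_cvg; apply: nearW => k.
  by rewrite /c_ !mulrBl mul1r mulrA.
have H := cvg_shortfall_tail c_ _ cc.
rewrite -(cvg_shiftn 2) /=; apply: cvg_trans H; apply: near_eq_cvg.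
apply: nearW => k /=; rewrite addn2; congr (P _).
have s0 : 0 < Num.sqrt k.+2%:R :> R by rewrite sqrtr_gt0.
have X1E w : X1 toss k.+2 w =
    (2 * k.+2)%:R - 1 - ((2 * k.+1).+1 - first_time toss k.+2 w)%N%:R.
  have /andP[_ F] := @first_time_bounds _ _ _ _ toss k.+1 w.
  rewrite natrB// (_ : 2 * k.+2 = (2 * k.+1).+2)%N; last by lia.
  by rewrite -[(2 * k.+1).+2%:R]natr1 /X1; ring.
apply/seteqP; split=> w /=; rewrite X1E ler_pdivrMr// /c_; lra.
Qed.

End Limit.

Theorem theorem4p2 (R : realType)
    (d : measure_display) (T : measurableType d) (P : probability T R)
    (toss : nat -> {RV P >-> bool}) (htoss : fair_coin_tosses toss)
    (d' : measure_display) (T' : measurableType d') (Q : probability T' R)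
    (Z : {RV Q >-> R}) (hZ : standard_normal Z) :
  cvg_in_distribution P Q
    (fun n w => (X1 toss n w - (2 * n)%:R) / Num.sqrt n%:R)
    (fun w => - Num.sqrt 2 * `|Z w|)
  /\
  cvg_in_distribution P Q
    (fun n w => (X1 toss n w - fine 'E_P[X1 toss n]) / Num.sqrt n%:R)
    (fun w => - Num.sqrt 2 * (`|Z w| - fine 'E_Q[fun w' => `|Z w'|])).
Proof.
split.
  under [X in cvg_in_distribution _ _ _ X]eq_fun do rewrite -[`|_|]subr0.
  apply: (cvg_X1_in_distribution htoss hZ (fun n => (2 * n)%:R)).
  by apply: cvg_near_cst; apply: nearW => k; rewrite subrr mul0r.
apply: (cvg_X1_in_distribution htoss hZ (fun n => fine 'E_P[X1 toss n])).
rewrite -[X in _ --> X]addr0.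
have H : shortfall_mean k / scale k + (scale k)^-1 @[k --> \oo] -->
    fine 'E_Q[fun w => `|Z w|] + 0.
  by apply: cvgD; [exact: (cvg_shortfall_mean htoss hZ)|exact: cvg_scaleV].
apply: cvg_trans H; apply: near_eq_cvg.
apply: nearW => k /=.
rewrite (expectation_X1 htoss)/= -/(shortfall_mean k).
rewrite (_ : 2 * k.+2 = (2 * k.+1).+2)%N; last by lia.
by rewrite -[(2 * k.+1).+2%:R]natr1 -[X in _ + X]mul1r -mulrDl; congr (_ / _); ring.
Qed.
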